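(* For every multi-source multicast instance on an undirected graph with $n$ vertices, the network coding gap is at most $O(\log n)$.
   Context: A multi-source multicast instance consists of an undirected graph $G=(V,E)$, $|V|=n$, with edge capacities $c:E\to\mathbb{R}_+$ and $k$ sessions $(s_i,R_i,d_i)$, $i\in[k]$, where $s_i\in V$ is a source, $R_i\subseteq V$ a set of sinks and $d_i>0$ a demand. Source $s_i$ holds a message $m_i$ drawn from a finite set $M_i$; the messages are independent random variables. A network coding solution: replace each undirected edge $e=\{u,v\}$ by two directed edges $\vec e=(u,v)$, $\overleftarrow e=(v,u)$; form the time-expanded graph with vertex set $V\times\mathbb{Z}$, an edge $(u^{(t-1)},v^{(t)})$ for each directed edge $(u,v)$ and each $t$, and memory edges $(v^{(t-1)},v^{(t)})$ of unlimited capacity. Each edge of the time-expanded graph carries a symbol that is a deterministic function of the symbols on the edges entering its tail (the copies of $s_i$ additionally know $m_i$); correctness requires that every sink $r\in R_i$ can compute $m_i$ from what arrives at the copies of $r$. Writing $X_{\vec e}$ for the collection over all time steps of symbols sent on the copies of $\vec e$, the solution achieves rate $\rho$ if there is a scale $c^*>0$ with $H(m_i)\ge \rho\, d_i\, c^*$ for all $i$ and $H(X_{\vec e})+H(X_{\overleftarrow e})\le c_e c^*$ for every edge $e$. The network coding throughput is the supremum of achievable rates over all message distributions and solutions. The multi-Steiner tree packing number $\tau$ is the maximum $\tau$ such that there exist weights $x_{i,T}\ge 0$, for $i\in[k]$ and trees $T\subseteq G$ spanning $S_i:=R_i\cup\{s_i\}$, with $\sum_T x_{i,T}\ge \tau d_i$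 for all $i$ and $\sum_{(i,T):e\in T}x_{i,T}\le c_e$ for all $e$. The network coding gap is (network coding throughput)$/\tau$.
   Formalization: A network coding solution is also required to have a starting time, before which all symbols are independent of the messages; without it, memory edges on V×Z could carry a message from time −∞ and every rate would be achievable. *)

(* Defs.v *)
From HB Require Import structures.
From mathcomp Require Import all_boot all_order all_algebra.
From mathcomp Require Import all_classical all_reals all_analysis.

Set Implicit Arguments.
Unset Strict Implicit.
Unset Printing Implicit Defensive.

Import Order.TTheory GRing.Theory Num.Theory.

Local Open Scope classical_set_scope.
Local Open Scope ring_scope.

(* The capacity of an edge matters only on [edges]; an edge is the
   two-element set of its endpoints. *)
Record instance (R : realType) := Instance {
  vertex : finType;
  edges : {set {set vertex}};
  edges_card : forall e, e \in edges -> #|e| = 2%N;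
  cap : {set vertex} -> R;
  cap_ge0 : forall e, e \in edges -> 0 <= cap e;
  nsess : nat;
  src : 'I_nsess -> vertex;
  sinks : 'I_nsess -> {set vertex};
  dem : 'I_nsess -> R;
  dem_gt0 : forall i, 0 < dem i }.

Definition terminals (R : realType) (I : instance R) (i : 'I_(nsess I)) :
  {set vertex I} := (src i |: sinks i)%SET.

Definition mass_fun (R : realType) (W : finType) (P : W -> R) (T : Type)
  (X : W -> T) (x : T) : R := \sum_(w | `[< X w = x >]) P w.

(* Natural logarithm: the base is immaterial, since rates are measured up to
   a common scale. *)
Definition entropy (R : realType) (W : finType) (P : W -> R) (T : Type)
    (X : W -> T) : R :=
  - \sum_(x \in range (X : W -> {classic T}))
      mass_fun P X x * ln (mass_fun P X x).

(* An edge (u^(t-1), v^(t)) of the time-expanded graph: the two orientations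
   of an edge of the graph, and the memory edges (u = v). *)
Definition time_arc (R : realType) (I : instance R) (u v : vertex I) : bool :=
  (u == v) || ([set u; v]%SET \in edges I).

Definition messages (k : nat) (M : 'I_k -> finType) : finType :=
  {dffun forall i : 'I_k, M i}.

(* The symbols on the edges entering u^(t), indexed by their tails. *)
Definition arriving (R : realType) (I : instance R) (W A : Type)
    (symbol : vertex I -> vertex I -> int -> W -> A)
    (u : vertex I) (t : int) (w : W) : vertex I -> option A :=
  fun x => if time_arc x u then Some (symbol x u t w) else None.

Definition own_messages (R : realType) (I : instance R)
    (M : 'I_(nsess I) -> finType) (u : vertex I) (w : messages M) :
    forall i, option (M i) :=
  fun i => if src i == u then Some (w i) else None.

(* The sample space is the set of message tuples under the product law
   [joint_law], so the messages are independent. [symbol u v t w] is the symbol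
   sent on the edge (u^(t-1), v^(t)) when the messages are [w].
   As time is indexed by all the integers, the local conditions [encodeP] alone
   do not force the symbols to originate at the sources: a memory edge could
   have been carrying a message forever. [startP] says that transmission
   starts at some time, before which the symbols carry no information. *)
Record solution (R : realType) (I : instance R) := Solution {
  msg : 'I_(nsess I) -> finType;
  law : forall i, msg i -> R;
  law_ge0 : forall i (m : msg i), 0 <= law m;
  law_sum1 : forall i, \sum_(m : msg i) law m = 1;
  alphabet : Type;
  symbol : vertex I -> vertex I -> int -> messages msg -> alphabet;
  encode : vertex I -> vertex I -> int ->
    (vertex I -> option alphabet) -> (forall i, option (msg i)) -> alphabet;
  encodeP : forall u v t w, time_arc u v ->
    symbol u v t w =
    encode u v t (arriving symbol u (t - 1) w) (own_messages u w);
  startP : exists t0 : int, forall u v t w w', time_arc u v -> t <= t0 ->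
    symbol u v t w = symbol u v t w';
  decode : forall i : 'I_(nsess I), vertex I ->
    (int -> vertex I -> option alphabet) -> msg i;
  decodeP : forall i r w, r \in sinks i ->
    decode i r (fun t => arriving symbol r t w) = w i }.

Definition joint_law (R : realType) (I : instance R) (N : solution I)
  (w : messages (@msg R I N)) : R := \prod_i @law R I N i (w i).

Definition message_entropy (R : realType) (I : instance R) (N : solution I)
    (i : 'I_(nsess I)) : R :=
  entropy (@joint_law R I N) (fun w => w i).

Definition arc_entropy (R : realType) (I : instance R) (N : solution I)
    (u v : vertex I) : R :=
  entropy (@joint_law R I N) (fun w => fun t : int => @symbol R I N u v t w).

Definition achieves (R : realType) (I : instance R) (N : solution I)
    (rho : R) : Prop :=
  exists2 s : R, 0 < s &
    (forall i, rho * dem i * s <= message_entropy N i) /\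
    (forall u v, [set u; v]%SET \in edges I ->
       arc_entropy N u v + arc_entropy N v u <= cap [set u; v]%SET * s).

Definition throughput (R : realType) (I : instance R) : \bar R :=
  ereal_sup [set rho%:E | rho in
    [set rho : R | exists N : solution I, achieves N rho]].

Definition edge_rel (V : finType) (F : {set {set V}}) : rel V :=
  fun u v => [set u; v]%SET \in F.

Definition acyclic (V : finType) (F : {set {set V}}) : Prop :=
  forall p : seq V, (2 < size p)%N -> ~ ucycle (edge_rel F) p.

(* A subgraph is a pair (vertex set, edge set). *)
Definition is_tree (R : realType) (I : instance R)
    (T : {set vertex I} * {set {set vertex I}}) : bool :=
  [&& T.1 != finset.set0, T.2 \subset edges I,
      [forall e in T.2, e \subset T.1],
      [forall u in T.1, [forall v in T.1, connect (edge_rel T.2) u v]] &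
      `[< acyclic T.2 >]].

Definition steiner_tree (R : realType) (I : instance R) (i : 'I_(nsess I))
    (T : {set vertex I} * {set {set vertex I}}) : bool :=
  is_tree T && (terminals i \subset T.1).

Definition packs (R : realType) (I : instance R)
    (x : 'I_(nsess I) -> {set vertex I} * {set {set vertex I}} -> R)
    (tau : R) : Prop :=
  [/\ forall i T, steiner_tree i T -> 0 <= x i T,
      forall i, tau * dem i <= \sum_(T | steiner_tree i T) x i T &
      forall e, e \in edges I ->
        \sum_i \sum_(T | steiner_tree i T && (e \in T.2)) x i T <= cap e].

(* The supremum is the maximum of the linear program, or +oo when the program
   is unbounded (every session has a single terminal). *)
Definition packing_number (R : realType) (I : instance R) : \bar R :=
  ereal_sup [set tau%:E | tau in
    [set tau : R | exists x, @packs R I x tau]].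

(* In \bar R, a / 0 = +oo for 0 < a and a / +oo = 0 for finite a; only the
   undefined forms 0 / 0 and +oo / +oo are given the conventional value 0. *)
Definition coding_gap (R : realType) (I : instance R) : \bar R :=
  (throughput I / packing_number I)%E.

(* Main.v *)
Require Import Defs.
From mathcomp Require Import all_boot all_order all_algebra.
From mathcomp Require Import all_classical all_reals all_analysis.
From mathcomp Require Import finmap fingroup perm fintype finset zify ring lra.

Set Implicit Arguments.
Unset Strict Implicit.
Unset Printing Implicit Defensive.

Import Order.TTheory GRing.Theory Num.Theory.

Local Open Scope ring_scope.

(** If no packing of value [tau] exists, LP duality gives edge lengths [l] and
    numbers [y i], at most the [l]-length of every Steiner tree of session [i],
    with [sum c l < tau * sum y d].  The shortest-path metric of [l] is
    approximated from above by a laminar family of partitions, at scales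
    [2 ^ k], in the manner of Fakcharoenphol, Rao and Talwar: clusters are balls
    around centres taken in a random order, and the total weight of the cuts is
    on average at most a harmonic sum times [sum c l].  Conversely each [y i] is
    at most a constant times the weight of the clusters that meet the sinks but
    avoid the source.  For a single cluster [U], the messages that must enter [U]
    have total entropy at most that of the symbols entering [U], because these
    symbols and all other messages together determine everything.  Summing this
    cut bound over all clusters gives [rho < 16 H_n tau]. *)

(** * Random low-diameter partitions *)

(** An order on [V] is encoded as a permutation, elements being compared through the ranks of their
    images; a uniform random order then becomes counting in [{perm V}]. *)
Definition first_in (V : finType) (B : {set V}) (x : V) (s : {perm V}) : bool :=
  [forall y in B, enum_rank (s x) <= enum_rank (s y)]%N.

(** Composing with [tperm x y] exchanges the orders in which [y] is first with those in which [x]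
    is, so all elements of [B] are first equally often, and no two are first at once. *)
Lemma card_first_in (V : finType) (B : {set V}) (x : V) : x \in B ->
  (#|[set s | first_in B x s]| * #|B| <= #|{perm V}|)%N.
Proof.
move=> xB.
have cardE y : y \in B ->
    #|[set s | first_in B y s]| = #|[set s | first_in B x s]|.
  move=> yB; rewrite -(card_imset _ (mulgI (tperm x y))).
  apply: eq_card => s; rewrite [RHS]inE.
  have tB z : z \in B -> tperm x y z \in B by case: tpermP => // ->.
  apply/imsetP/forall_inP => [[s' s'P ->] z zB|sP].
    move: s'P; rewrite inE => /forall_inP s'P.
    by rewrite !permM tpermL s'P ?tB.
  exists (tperm x y * s)%g; last by rewrite mulgA tperm2 mul1g.
  rewrite inE; apply/forall_inP => z zB.
  by rewrite !permM tpermR sP ?tB.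
rewrite mulnC -sum_nat_const -(eq_bigr _ cardE).
under eq_bigr do rewrite -sum1_card big_mkcond.
rewrite exchange_big /= -sum1_card; apply: leq_sum => s _.
rewrite -big_mkcondr /= sum1dep_card.
apply/card_le1_eqP => y z; rewrite !inE => /andP[yB /forall_inP yP] /andP[zB /forall_inP zP].
apply/(@perm_inj _ s)/enum_rank_inj/val_inj/eqP.
by rewrite eqn_leq yP ?zP.
Qed.

(** Listed by increasing [m], the element at position [i], counted from 1, has a count of at least
    [i]. The induction removes an element of maximal [m], whose count is all of [A]. *)
Lemma sum_inv_card_le (F : realFieldType) (V : finType) (m : V -> nat) (A : {set V}) :
  \sum_(x in A) (#|[set y in A | (m y <= m x)%N]|%:R : F)^-1
    <= \sum_(0 <= i < #|A|) i.+1%:R^-1.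
Proof.
elim: {A}_.+1 {-2}A (ltnSn #|A|) => // n IHn A; rewrite ltnS => An.
have [->|[x0 x0A]] := set_0Vmem A; first by rewrite big_set0 cards0 big_geq.
have [x xA xmax] : exists2 x, x \in A & forall y, y \in A -> (m y <= m x)%N.
  by case: (arg_maxnP m x0A) => x; exists x.
have cA : #|A| = #|A :\ x|.+1 by rewrite (cardsD1 x) xA.
rewrite (big_setD1 x xA) /= [in leRHS]cA big_nat_recr //= -cA addrC lerD //.
  have le' : (#|A :\ x| < n.+1)%N by rewrite ltnS -ltnS -cA ltnW.
  have /IHn : (#|A :\ x| < n)%N by rewrite -cA.
  apply: le_trans; apply: ler_sum => z /setD1P[zx zA].
  have pos (C : {set V}) : z \in C -> #|[set y in C | (m y <= m z)%N]| %:R \is @Num.pos F.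
    by move=> zC; rewrite posrE ltr0n card_gt0; apply/set0Pn; exists z; rewrite inE zC leqnn.
  rewrite lef_pV2 ?pos ?ler_nat ?inE ?zx //.
  by apply: subset_leq_card; apply/subsetP => y; rewrite !inE -andbA => /and3P[_ -> ->].
rewrite lef_pV2 ?posrE ?ltr0n ?cA //; first last.
  by rewrite card_gt0; apply/set0Pn; exists x; rewrite inE xA leqnn.
rewrite -cA ler_nat; apply: subset_leq_card; apply/subsetP => y yA.
by rewrite inE yA xmax.
Qed.

(** Ball carving: [v] joins the first centre within radius [r]. The default [v] is itself a
    candidate once [d v v = 0]. *)
Definition center (V : finType) (d : V -> V -> nat) (r : nat) (s : {perm V}) (v : V) : V :=
  [arg min_(x < v | (d x v <= r)%N) enum_rank (s x)]%N.

Lemma centerP (V : finType) (d : V -> V -> nat) r s v : d v v = 0%N ->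
  (d (center d r s v) v <= r)%N /\
  forall y, (d y v <= r)%N -> (enum_rank (s (center d r s v)) <= enum_rank (s y))%N.
Proof.
move=> d0; rewrite /center; case: arg_minnP; first by rewrite d0.
by move=> x xr xmin; split.
Qed.

(* The first centre reaching [u] or [v] reaches only one of them. *)
Lemma center_neq (V : finType) (d : V -> V -> nat) r s u v :
    d u u = 0%N -> d v v = 0%N -> center d r s u != center d r s v ->
  exists x, (minn (d x u) (d x v) <= r < maxn (d x u) (d x v))%N &&
    first_in [set y | minn (d y u) (d y v) <= minn (d x u) (d x v)]%N x s.
Proof.
move=> du dv.
have [] := centerP r s du; have [] := centerP r s dv.
set cu := center d r s u; set cv := center d r s v => cvr cvm cur cum cuv.
have main a b ca cb : (d ca a <= r)%N -> (forall y, (d y b <= r)%N ->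
      (enum_rank (s cb) <= enum_rank (s y))%N) ->
    (forall y, (d y a <= r)%N -> (enum_rank (s ca) <= enum_rank (s y))%N) ->
    (enum_rank (s ca) < enum_rank (s cb))%N ->
    (minn (d ca a) (d ca b) <= r < maxn (d ca a) (d ca b))%N &&
    first_in [set y | minn (d y a) (d y b) <= minn (d ca a) (d ca b)]%N ca s.
  move=> car cbm cam lt_ab.
  (* Since [ca] strictly precedes the centre of [b], it cannot reach [b]. *)
  have cab : (r < d ca b)%N by rewrite ltnNge; apply/negP => /cbm; rewrite leqNgt lt_ab.
  rewrite geq_min car leq_max cab orbT /=.
  apply/forall_inP => y; rewrite inE => ym.
  have: (minn (d y a) (d y b) <= r)%N by rewrite (leq_trans ym)// geq_min car.
  by rewrite geq_min => /orP[/cam //|/cbm]; apply: leq_trans; apply: ltnW.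
have [lt|lt|eq] := ltngtP (enum_rank (s cu)) (enum_rank (s cv)).
- by exists cu; apply: main cvm _ _.
- exists cv; rewrite minnC maxnC.
  have -> : [set y | minn (d y u) (d y v) <= minn (d cv v) (d cv u)]%N
      = [set y | minn (d y v) (d y u) <= minn (d cv v) (d cv u)]%N.
    by apply/setP => y; rewrite !inE [minn (d y u) _]minnC.
  exact: main cum _ _.
- by move: cuv; rewrite (perm_inj (enum_rank_inj (val_inj eq))) eqxx.
Qed.

(** The radii [2 ^ k + j] of the levels below [K] tile the range from [1] to [2 ^ K - 1]. No radius
    is charged at two levels, so summing over the levels costs no factor [K]. *)
Lemma sum_dyadic (f : nat -> nat) (K : nat) :
  (\sum_(0 <= k < K) \sum_(j < 2 ^ k) f (2 ^ k + j) = \sum_(1 <= r < 2 ^ K) f r)%N.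
Proof.
elim: K => [|K IHK]; first by rewrite !big_geq.
rewrite big_nat_recr //= IHK [RHS](@big_cat_nat _ _ _ (2 ^ K)) ?expn_gt0 ?leq_exp2l //=.
congr addn; rewrite -[X in (\sum_(X <= _ < _) _)%N]add0n big_addn.
rewrite expnS mul2n -addnn addnK big_mkord.
by apply: eq_bigr => j _; rewrite addnC.
Qed.

Lemma sum_interval_le (m M a b : nat) :
  (\sum_(a <= r < b) (m <= r < M)%N <= M - m)%N.
Proof.
rewrite -big_mkcond /= sum1_count -size_filter -[leqRHS](size_iota m).
apply: uniq_leq_size; first by rewrite filter_uniq // iota_uniq.
move=> r; rewrite mem_filter mem_iota => /andP[/andP[mr rM] _].
by rewrite mr subnKC // ltnW // (leq_ltn_trans mr).
Qed.

Lemma exists_le_average (F : realFieldType) (T : finType) (t0 : T) (f : T -> F) :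
  exists t, #|T|%:R * f t <= \sum_t f t.
Proof.
case: (@Order.TotalTheory.arg_minP _ F T t0 xpredT f erefl) => t _ tmin.
exists t; rewrite mulr_natl -sumr_const; apply: ler_sum => i _; exact: tmin.
Qed.

Definition harmonic_sum (F : realFieldType) (n : nat) : F :=
  \sum_(0 <= i < n) i.+1%:R^-1.

(** A centre [x] separates [u] from [v] with probability at most its chance to be first among the
    points at least as near, times the fraction of radii between its two distances. The factor
    [2 ^+ k] cancels the density of the radii of level [k]. At each level some choice is no worse
    than average. *)
Lemma low_diameter_partitions (F : realFieldType) (V : finType) (d : V -> V -> nat)
    (a : V -> V -> F) (K : nat) :
    (forall u, d u u = 0%N) -> (forall u v, d u v = d v u) ->
    (forall u v w, d u w <= d u v + d v w)%N -> (forall u v, 0 <= a u v) ->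
  exists P : nat -> V -> V,
    (forall k u v, P k u = P k v -> (d u v + 2 <= 2 ^ k.+2)%N) /\
    \sum_(0 <= k < K) 2 ^+ k * (\sum_u \sum_v a u v * (P k u != P k v)%:R)
      <= harmonic_sum F #|V| * \sum_u \sum_v a u v * (d u v)%:R.
Proof.
move=> d0 dC dT a0.
pose g k (p : {perm V} * 'I_(2 ^ k)) := center d (2 ^ k + p.2) p.1.
pose f k (p : {perm V} * 'I_(2 ^ k)) :=
  \sum_u \sum_v a u v * (g k p u != g k p v)%:R.
have t0 k : 'I_(2 ^ k) by exists 0%N; rewrite expn_gt0.
have ex k : exists p, #|{: {perm V} * 'I_(2 ^ k)}|%:R * f k p <= \sum_p f k p.
  exact: exists_le_average (1%g, t0 k) _.
have [p pP] : exists p : forall k, {perm V} * 'I_(2 ^ k),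
    forall k, #|{: {perm V} * 'I_(2 ^ k)}|%:R * f k (p k) <= \sum_p f k p.
  by exists (fun k => xchoose (ex k)) => k; apply: xchooseP (ex k).
exists (fun k => g k (p k)); split.
  move=> k u v E.
  have [cu _] := centerP (2 ^ k + (p k).2) (p k).1 (d0 u).
  have [cv _] := centerP (2 ^ k + (p k).2) (p k).1 (d0 v).
  have := ltn_ord (p k).2; move: cu cv; rewrite /g in E; rewrite -E dC => cu cv lt.
  (* The radius is at most [2 ^ k.+1 - 1], so twice the radius leaves slack [2] below [2 ^ k.+2]. *)
  have le := leq_trans (dT _ _ _) (leq_add cu cv).
  apply: (@leq_trans ((2 ^ k + (p k).2).+1 + (2 ^ k + (p k).2).+1)%N).
    by rewrite addn2 addSn addnS !ltnS.
  by rewrite addnn -mul2n expnS leq_mul2l /= expnS mul2n -addnn -addnS leq_add2l.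
pose m u v x := minn (d x u) (d x v); pose M u v x := maxn (d x u) (d x v).
pose B u v x := [set y | m u v y <= m u v x]%N.
pose h k u v x := (\sum_(j < 2 ^ k) (m u v x <= 2 ^ k + j < M u v x))%N.
have nperm : (0 : F) < #|{perm V}|%:R by rewrite ltr0n; apply/card_gt0P; exists 1%g.
(* Union bound over the centre given by [center_neq]; order and radius are independent, so the count
   factors. *)
have cut k u v : \sum_(q : {perm V} * 'I_(2 ^ k)) (g k q u != g k q v)%:R
    <= #|{perm V}|%:R * \sum_x (#|B u v x|%:R)^-1 * (h k u v x)%:R :> F.
  apply: (@le_trans _ _ (\sum_x
    #|[set s | first_in (B u v x) x s]|%:R * (h k u v x)%:R)); last first.
    rewrite mulr_sumr; apply: ler_sum => x _; rewrite mulrA ler_wpM2r //.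
    have xB : x \in B u v x by rewrite inE.
    rewrite ler_pdivlMr -?natrM ?ler_nat ?card_first_in // ltr0n card_gt0.
    by apply/set0Pn; exists x.
  under [leRHS]eq_bigr do rewrite -natrM.
  rewrite -!natr_sum ler_nat.
  have cardE x : (#|[set s | first_in (B u v x) x s]| * h k u v x =
      \sum_(q : {perm V} * 'I_(2 ^ k)) first_in (B u v x) x q.1 *
        (m u v x <= 2 ^ k + q.2 < M u v x))%N.
    rewrite -(pair_bigA _ (fun s (j : 'I_(2 ^ k)) => first_in (B u v x) x s *
      (m u v x <= 2 ^ k + j < M u v x)%N)%N) /=.
    rewrite -sum1dep_card big_mkcond big_distrl; apply: eq_bigr => s _.
    by rewrite -big_distrr.
  under [leqRHS]eq_bigr do rewrite cardE.
  rewrite /= exchange_big /=; apply: leq_sum => q _.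
  case: eqP => // /eqP/center_neq => /(_ (d0 _) (d0 _))[x /andP[xr xf]].
  by rewrite (bigD1 x) //= xf xr.
have level k : 2 ^+ k * f k (p k)
    <= \sum_u \sum_v a u v * \sum_x (#|B u v x|%:R)^-1 * (h k u v x)%:R.
  rewrite -(ler_pM2l nperm) mulrA; have := pP k.
  rewrite card_prod card_ord natrM natrX => /le_trans; apply.
  rewrite /f exchange_big [leRHS]mulr_sumr; apply: ler_sum => u _ /=.
  rewrite exchange_big [leRHS]mulr_sumr; apply: ler_sum => v _ /=.
  by rewrite -mulr_sumr mulrCA ler_wpM2l ?a0 ?cut.
apply: (@le_trans _ _ (\sum_(0 <= k < K) \sum_u \sum_v
    a u v * \sum_x (#|B u v x|%:R)^-1 * (h k u v x)%:R)).
  by apply: ler_sum => k _; exact: level.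
rewrite exchange_big [leRHS]mulr_sumr; apply: ler_sum => u _ /=.
rewrite exchange_big [leRHS]mulr_sumr; apply: ler_sum => v _ /=.
rewrite -mulr_sumr mulrCA ler_wpM2l ?a0 // exchange_big /=.
(* Over all levels, the radii that let [x] separate the pair number at most [|d x u - d x v|], hence
   at most [d u v]. *)
apply: (@le_trans _ _ (\sum_x (#|B u v x|%:R)^-1 * (d u v)%:R)).
  apply: ler_sum => x _; rewrite -mulr_sumr ler_wpM2l ?invr_ge0 // -natr_sum ler_nat.
  rewrite /h (sum_dyadic (fun r => (m u v x <= r < M u v x)%N : nat)).
  apply: leq_trans (sum_interval_le _ _ _ _) _; rewrite /m /M leq_subLR.
  have := dT x u v; have := dT x v u; rewrite [d v u]dC => h1 h2.
  by case: (leqP (d x u) (d x v)).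
rewrite -mulr_suml ler_wpM2r //.
have := @sum_inv_card_le F V (m u v) [set: V]; rewrite cardsT big_mkcond /=.
apply: le_trans; apply: ler_sum => x _; rewrite inE.
have -> // : [set y in [set: V] | (m u v y <= m u v x)%N] = B u v x.
by apply/setP => y; rewrite !inE.
Qed.

(** * Steiner trees and the shortest-path metric *)

Lemma edge_connect_sym (V : finType) (F : {set {set V}}) : connect_sym (edge_rel F).
Proof. by apply: sym_connect_sym => u v; rewrite /edge_rel setUC. Qed.

Lemma connect_edge_subset (V : finType) (F G : {set {set V}}) u v : F \subset G ->
  connect (edge_rel F) u v -> connect (edge_rel G) u v.
Proof.
by move=> /subsetP FG; apply: connect_sub => x y xy; apply/connect1/FG.
Qed.

Lemma path_avoid (V : finType) (F : {set {set V}}) (e : {set V}) u p :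
  path (edge_rel F) u p -> {in belast u p, forall x, x \notin e} ->
  path (edge_rel (F :\ e)%SET) u p.
Proof.
elim: p u => //= v p IHp u /andP[uv vp] avoid.
rewrite IHp // ?andbT => [|x xp]; last by rewrite avoid // inE xp orbT.
rewrite /edge_rel !inE -/(edge_rel F u v) uv andbT.
apply: contraNneq (avoid u (mem_head _ _)) => <-.
by rewrite !inE eqxx.
Qed.

(** The rest of the cycle leads from [y] back to [x] without the removed edge, and this detour
    replaces every use of that edge. *)
Lemma cycle_edge_redundant (V : finType) (F : {set {set V}}) x y p :
    (0 < size p)%N -> ucycle (edge_rel F) [:: x, y & p] ->
  forall u v, connect (edge_rel F) u v -> connect (edge_rel (F :\ [set x; y])%SET) u v.
Proof.
case: p => // z p _ /andP[/= /and3P[xy yz zp] /and3P[]].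
rewrite !inE !negb_or => /and3P[xny xnz xnp] /andP[ynz ynp] _.
have cxy : connect (edge_rel (F :\ [set x; y])%SET) x y.
  rewrite edge_connect_sym; apply: (@connect_trans _ _ z).
    apply: connect1; rewrite /edge_rel !inE -/(edge_rel F y z) yz andbT.
    apply/eqP => /setP/(_ z); rewrite !inE eqxx orbT.
    by rewrite eq_sym (negPf xnz) eq_sym (negPf ynz).
  apply/connectP; exists (rcons p x); last by rewrite last_rcons.
  apply: path_avoid => // a; rewrite belast_rcons !inE negb_or.
  case/predU1P => [->|ap]; first by rewrite eq_sym xnz eq_sym ynz.
  by rewrite (memPn xnp) // (memPn ynp).
move=> u v; apply: connect_sub => a b ab.
have [eab|neq] := eqVneq [set a; b]%SET [set x; y]%SET; last first.
  by apply: connect1; rewrite /edge_rel !inE neq.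
have := set21 a b; rewrite eab; have := set22 a b; rewrite eab.
rewrite !inE => /orP[]/eqP-> /orP[]/eqP-> //.
by rewrite edge_connect_sym.
Qed.

(** A connecting subset of [F] of least cardinality is acyclic by [cycle_edge_redundant]; its
    restriction to the component of the source is the tree. *)
Lemma steiner_tree_in (R : realType) (I : instance R) (i : 'I_(nsess I))
    (F : {set {set vertex I}}) :
    F \subset edges I ->
    (forall r, r \in sinks i -> connect (edge_rel F) (src i) r) ->
  exists2 T, steiner_tree i T & T.2 \subset F.
Proof.
move=> FE Fc; pose s := src i.
pose spans (G : {set {set vertex I}}) :=
  (G \subset F) && [forall r in sinks i, connect (edge_rel G) s r].
have spansF : spans F by rewrite /spans subxx; apply/forall_inP.
case: (arg_minnP (fun G : {set _} => #|G|) spansF) => G /andP[GF /forall_inP Gc] Gmin.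
have acG : acyclic G.
  case=> [|x [|y p]] // p0 cyc.
  have xyG : [set x; y]%SET \in G by case/andP: cyc => /andP[].
  have /Gmin : spans (G :\ [set x; y])%SET.
    rewrite /spans (subset_trans (subsetDl _ _) GF); apply/forall_inP => r /Gc.
    by apply: cycle_edge_redundant cyc _ _; move: p0; case: (p).
  by rewrite (cardsD1 [set x; y]%SET G) xyG ltnn.
pose T1 := [set v | connect (edge_rel G) s v]%SET.
pose T2 := [set e in G | e \subset T1]%SET.
have T2G : T2 \subset G by apply/subsetP => e; rewrite inE => /andP[].
have sT1 : s \in T1 by rewrite inE connect0.
have T2c v : v \in T1 -> connect (edge_rel T2) s v.
  have sub p u : u \in T1 -> path (edge_rel G) u p -> path (edge_rel T2) u p.
    elim: p u => //= w p IHp u uT /andP[uw wp].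
    have wT : w \in T1.
      by move: uT; rewrite !inE => /connect_trans; apply; apply: connect1.
    rewrite IHp // andbT /edge_rel inE -/(edge_rel G u w) uw.
    by apply/subsetP => z; rewrite inE => /orP[]; rewrite inE => /eqP->.
  by rewrite inE => /connectP[p sp ->]; apply/connectP; exists p; rewrite // sub.
exists (T1, T2); last exact: subset_trans T2G GF.
apply/andP; split; last first.
  apply/subsetP => v; rewrite !inE => /predU1P[->|/Gc //]; exact: connect0.
apply/and5P; split => /=.
- by apply/set0Pn; exists s.
- exact: subset_trans T2G (subset_trans GF FE).
- by apply/forall_inP => e; rewrite inE => /andP[].
- apply/forall_inP => u /T2c su; apply/forall_inP => v /T2c.
  by apply: connect_trans; rewrite edge_connect_sym.
- apply/asboolP => p p2 /andP[cyc up]; apply: (acG p p2); rewrite /ucycle up andbT.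
  by apply: sub_cycle cyc => x y; apply: (subsetP T2G).
Qed.

Definition cost (V : finType) (l : {set V} -> nat) (F : {set {set V}}) : nat :=
  (\sum_(e in F) l e)%N.

Lemma cost_setU (V : finType) (l : {set V} -> nat) F G :
  (cost l (F :|: G) <= cost l F + cost l G)%N.
Proof.
rewrite /cost (big_setID F) /= setUK leq_add2l setDUl setDv set0U.
by rewrite [leqRHS](big_setID F) /= leq_addl.
Qed.

(** A cheapest connecting edge set instead of a path, so that the triangle inequality follows by
    taking unions. Pairs outside the graph are allowed; the choice of [l] in [integral_packing_dual]
    makes them expensive. *)
Definition geodesic (V : finType) (l : {set V} -> nat) (u v : V) : {set {set V}} :=
  [arg min_(F < [set: {set V}]%SET | connect (edge_rel F) u v) cost l F]%N.

Definition dist (V : finType) (l : {set V} -> nat) (u v : V) : nat :=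
  cost l (geodesic l u v).

Lemma geodesicP (V : finType) (l : {set V} -> nat) u v :
  connect (edge_rel (geodesic l u v)) u v /\
  forall F : {set {set V}}, connect (edge_rel F) u v -> (dist l u v <= cost l F)%N.
Proof.
rewrite /dist /geodesic; case: arg_minnP; last by [].
by apply: connect1; rewrite /edge_rel inE.
Qed.

Lemma distxx (V : finType) (l : {set V} -> nat) u : dist l u u = 0%N.
Proof.
apply/eqP; rewrite -leqn0; have [_ /(_ set0)] := geodesicP l u u.
by rewrite /cost big_set0; apply; apply: connect0.
Qed.

Lemma distC (V : finType) (l : {set V} -> nat) u v : dist l u v = dist l v u.
Proof.
have le a b : (dist l a b <= dist l b a)%N.
  by apply (geodesicP l a b).2; rewrite edge_connect_sym (geodesicP l b a).1.
by apply/eqP; rewrite eqn_leq !le.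
Qed.

Lemma dist_triangle (V : finType) (l : {set V} -> nat) u v w :
  (dist l u w <= dist l u v + dist l v w)%N.
Proof.
apply: leq_trans (cost_setU l _ _); apply (geodesicP l u w).2.
apply: (@connect_trans _ _ v).
  exact: connect_edge_subset (subsetUl _ _) (geodesicP l u v).1.
exact: connect_edge_subset (subsetUr _ _) (geodesicP l v w).1.
Qed.

Lemma dist_edge (V : finType) (l : {set V} -> nat) u v :
  (dist l u v <= l [set u; v]%SET)%N.
Proof.
have [_ /(_ [set [set u; v]]%SET)] := geodesicP l u v.
by rewrite /cost big_set1; apply; apply: connect1; rewrite /edge_rel inE.
Qed.

Lemma dist_lower_bound (V : finType) (l : {set V} -> nat) c u v :
  (forall e, c <= l e)%N -> u != v -> (c <= dist l u v)%N.
Proof.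
move=> lc uv; have [/connectP[p]] := geodesicP l u v.
case: p => [_ /= vu|w p /andP[uw _] _ _]; first by rewrite vu eqxx in uv.
apply: leq_trans (lc [set u; w]%SET) _.
by rewrite /dist /cost (bigD1 [set u; w]%SET) //= leq_addr.
Qed.

(* The common refinement of the partitions at levels [k, .., K - 1], which
   makes the family laminar. *)
Definition block (V : finType) (P : nat -> V -> V) (K k : nat) (u : V) : {set V} :=
  [set v | [forall j : 'I_K, (k <= j)%N ==> (P j u == P j v)]]%SET.

Lemma block_self (V : finType) (P : nat -> V -> V) K k u : u \in block P K k u.
Proof. by rewrite inE; apply/forallP => j; rewrite eqxx implybT. Qed.

Lemma blockP (V : finType) (P : nat -> V -> V) K k u v :
  reflect (forall j, (k <= j < K)%N -> P j u = P j v) (v \in block P K k u).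
Proof.
rewrite inE; apply: (iffP forallP) => [uv j /andP[kj jK]|uv j].
  by have := uv (Ordinal jK); rewrite kj => /eqP.
by apply/implyP => kj; apply/eqP/uv; rewrite kj ltn_ord.
Qed.

Lemma eq_block (V : finType) (P : nat -> V -> V) K k u v :
  (block P K k u == block P K k v) = (v \in block P K k u).
Proof.
apply/eqP/idP => [->|/blockP uv]; first exact: block_self.
by apply/setP => w; apply/blockP/blockP => H j jk; rewrite -H ?uv.
Qed.

Lemma blockC (V : finType) (P : nat -> V -> V) K k u v :
  (v \in block P K k u) = (u \in block P K k v).
Proof. by rewrite -!eq_block eq_sym. Qed.

Lemma sum_pow2 n : (\sum_(0 <= k < n) 2 ^ k).+1 = (2 ^ n)%N.
Proof.
elim: n => [|n IHn]; first by rewrite big_geq.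
by rewrite big_nat_recr //= -addSn IHn addnn -mul2n -expnS.
Qed.

(* Each sink is joined to the closest earlier terminal, where closeness means
   sharing a block of the lowest level; at every lower level it then opens a
   new block. *)
Lemma spanning_cost (V : finType) (l : {set V} -> nat) (P : nat -> V -> V) (K : nat)
    (s : V) (rs : seq V) :
    (forall k u v, P k u = P k v -> (dist l u v + 2 <= 2 ^ k.+2)%N) ->
    (forall u v, dist l u v < 2 ^ K)%N ->
    (forall u v, u != v -> 2 < dist l u v)%N ->
  exists2 F : {set {set V}}, (forall r, r \in rs -> connect (edge_rel F) s r) &
    (cost l F <= 8 * \sum_(0 <= k < K)
      2 ^ k * #|[set block P K k r | r in rs] :\ block P K k s|)%N.
Proof.
move=> Pd dK d3; elim: rs => [|r rs [F Fc Fcost]].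
  by exists set0 => //; rewrite /cost big_set0.
pose near k := has (fun p => p \in block P K k r) (s :: rs).
have nearK : exists k, near k.
  exists K; apply/orP; left; apply/blockP => j /andP[Kj].
  by rewrite ltnNge Kj.
case: (ex_minnP nearK) => k0 /hasP[p ps pr] k0min.
have k0K : (k0 <= K)%N.
  by apply: k0min; apply/orP; left; apply/blockP => j /andP[Kj]; rewrite ltnNge Kj.
(* For [k0 < K] the distance is at most [4 * 2 ^ k0 - 2] and the sum is [2 ^ k0 - 1]. This suffices
   unless [k0 = 0], where a distance of at most [2] forces [r = p]. For [k0 = K] the bound [2 ^ K]
   on all distances takes over. *)
have dpr : (dist l p r <= 8 * \sum_(0 <= k < k0) 2 ^ k)%N.
  have [->|rp] := eqVneq r p; first by rewrite distxx.
  have pow := sum_pow2 k0.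
  have d2 := d3 _ _ rp.
  have [k0ltK|] := ltnP k0 K.
    have le : (dist l r p + 2 <= 2 ^ k0.+2)%N.
      by apply: Pd; move/blockP: pr; apply; rewrite leqnn.
    rewrite distC; move: le; rewrite !expnS; lia.
  rewrite leq_eqVlt ltnNge k0K orbF => /eqP eK; rewrite -eK in pow.
  rewrite distC; have := dK r p; rewrite -eK; lia.
exists (F :|: geodesic l p r).
  move=> q; rewrite inE => /predU1P[->|qrs]; last first.
    exact: connect_edge_subset (subsetUl _ _) (Fc _ qrs).
  apply: (@connect_trans _ _ p); last first.
    exact: connect_edge_subset (subsetUr _ _) (geodesicP l p r).1.
  move: ps; rewrite inE => /predU1P[->|prs]; first exact: connect0.
  exact: connect_edge_subset (subsetUl _ _) (Fc _ prs).
apply: leq_trans (cost_setU _ _ _) _; apply: leq_trans (leq_add Fcost dpr) _.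
rewrite -mulnDr leq_mul2l /=.
rewrite (@big_cat_nat _ _ _ k0) // /= [leqRHS](@big_cat_nat _ _ _ k0) // /=.
rewrite addnAC; apply: leq_add; last first.
  apply: leq_sum => k _; rewrite leq_mul2l; apply/orP; right.
  by apply/subset_leq_card/setSD/imsetS/subsetP; exact: (@mem_behead _ (r :: rs)).
rewrite -big_split /= big_nat [leqRHS]big_nat; apply: leq_sum => k /andP[_ kk0].
rewrite -{2}[(2 ^ k)%N]muln1 -mulnDr leq_mul2l; apply/orP; right.
have /hasPn far : ~~ near k by apply/negP => /k0min; rewrite leqNgt kk0.
rewrite [leqRHS](cardsD1 (block P K k r)) addnC leq_add //.
  rewrite lt0b !inE eq_block far ?mem_head //=.
  by apply: imset_f; apply: mem_head.
apply/subset_leq_card/subsetP => C; rewrite !inE => /andP[Cs /imsetP[q qrs Cq]].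
rewrite Cs {1}Cq eq_block blockC far ?inE ?qrs ?orbT //=.
by apply/imsetP; exists q; rewrite // !inE qrs orbT.
Qed.

(** * Linear programming duality *)

Lemma separating_point (F : realFieldType) (M : finType) (P Q : pred M) (lo hi : M -> F) :
    (forall p q, P p -> Q q -> lo q <= hi p) ->
  exists x, (forall q, Q q -> lo q <= x) /\ (forall p, P p -> x <= hi p).
Proof.
move=> H; have [/existsP[q0 Qq0]|/existsPn noQ] := boolP [exists q, Q q].
  have [q Qq qmax] := @Order.TotalTheory.arg_maxP _ F M q0 Q lo Qq0.
  by exists (lo q); split=> // p Pp; apply: H.
have [/existsP[p0 Pp0]|/existsPn noP] := boolP [exists p, P p].
  have [p Pp pmin] := @Order.TotalTheory.arg_minP _ F M p0 P hi Pp0.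
  by exists (hi p); split=> // q Qq; case/negP: (noQ q).
by exists 0; split=> m Hm; [case/negP: (noQ m) | case/negP: (noP m)].
Qed.

Lemma sum_indicator (F : nzRingType) (M : finType) (m : M) (f : M -> F) :
  \sum_m' (m' == m)%:R * f m' = f m.
Proof.
by rewrite (bigD1 m) //= eqxx mul1r big1 ?addr0 // => m' /negPf->; rewrite mul0r.
Qed.

(* Fourier-Motzkin: to eliminate [x j0], keep the inequalities in which it has
   coefficient 0 and combine each pair in which its coefficients have opposite
   signs. *)
Lemma farkas (F : realFieldType) (J : finType) (A : {set J}) (M : finType)
    (a : M -> J -> F) (b : M -> F) :
  (exists x, forall m, \sum_(j in A) a m j * x j <= b m) \/
  (exists l, [/\ forall m, 0 <= l m, forall j, j \in A -> \sum_m l m * a m j = 0 &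
    \sum_m l m * b m < 0]).
Proof.
elim: {A}_.+1 {-2}A (ltnSn #|A|) M a b => // n IHn A; rewrite ltnS => An M a b.
have [->|[j0 j0A]] := set_0Vmem A.
  have [/forallP b0|/forallPn[m]] := boolP [forall m, 0 <= b m].
    by left; exists (fun=> 0) => m; rewrite big_set0.
  rewrite -ltNge => bm; right; exists (fun m' => (m' == m)%:R); split=> [m'|j|].
  - exact: ler0n.
  - by rewrite inE.
  - by rewrite sum_indicator.
(* The rows of the reduced system as nonnegative combinations of the old ones: [inl] keeps a row,
   [inr] combines a pair. The leading indicator makes the row trivial when the signs do not fit. *)
pose w (t : M + M * M) (m : M) : F := match t with
  | inl m0 => (a m0 j0 == 0)%:R * (m == m0)%:R
  | inr (p, q) => ((0 < a p j0) && (a q j0 < 0))%:R *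
      ((m == p)%:R * (- a q j0) + (m == q)%:R * a p j0)
  end.
have w0 t m : 0 <= w t m.
  case: t => [m0|[p q]] /=; first by rewrite mulr_ge0.
  case: andP => [[p0 q0]|_]; rewrite ?mul0r // mul1r.
  by rewrite addr_ge0 // mulr_ge0 // ?oppr_ge0 ltW.
have wE t (f : M -> F) : \sum_m w t m * f m = match t with
  | inl m0 => (a m0 j0 == 0)%:R * f m0
  | inr (p, q) => ((0 < a p j0) && (a q j0 < 0))%:R * (- a q j0 * f p + a p j0 * f q)
  end.
  case: t => [m0|[p q]] /=.
    by under eq_bigr do rewrite -mulrA; rewrite -mulr_sumr sum_indicator.
  under eq_bigr do rewrite -mulrA mulrDl -!mulrA.
  by rewrite -mulr_sumr big_split /= !sum_indicator.
have wj0 t : \sum_m w t m * a m j0 = 0.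
  rewrite wE; case: t => [m0|[p q]].
    by case: eqP => [->|]; rewrite ?mulr0 ?mul0r.
  by rewrite [a p j0 * _]mulrC mulNr addNr mulr0.
have cA : (#|A :\ j0| < n)%N by move: An; rewrite (cardsD1 j0 A) j0A.
have [[x xP]|[l [l0 la lb]]] := IHn (A :\ j0) cA (M + M * M)%type
  (fun t j => \sum_m w t m * a m j) (fun t => \sum_m w t m * b m).
  left; pose v m := \sum_(j in A :\ j0) a m j * x j.
  have {}xP t : \sum_m w t m * v m <= \sum_m w t m * b m.
    apply: le_trans (xP t); rewrite /v.
    under eq_bigr do rewrite mulr_sumr.
    rewrite exchange_big /=; apply: ler_sum => j _; rewrite mulr_suml.
    by apply: ler_sum => m _; rewrite mulrA.
  (* Rows with a negative coefficient bound [x j0] from below, those with a positive one from above;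
     the combined rows say that these bounds are compatible. *)
  have [|z [zlo zhi]] := @separating_point F M (fun p => 0 < a p j0) (fun q => a q j0 < 0)
    (fun q => (b q - v q) / a q j0) (fun p => (b p - v p) / a p j0).
    move=> p q p0 q0; have := xP (inr (p, q)); rewrite !wE p0 q0 !mul1r => H.
    rewrite ler_pdivlMr // mulrAC ler_ndivrMr //; lra.
  exists (fun j => if j == j0 then z else x j) => m.
  rewrite (big_setD1 j0 j0A) /= eqxx.
  rewrite (_ : \sum_(j in _) _ = v m); last first.
    by apply: eq_bigr => j; rewrite !inE => /andP[/negPf-> _].
  have [m0|m0|m0] := ltgtP (a m j0) 0.
  - by have := zlo m m0; rewrite ler_ndivrMr // mulrC; lra.
  - by have := zhi m m0; rewrite ler_pdivlMr // mulrC; lra.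
  - by have := xP (inl m); rewrite !wE m0 eqxx !mul1r mul0r add0r.
right; exists (fun m => \sum_t l t * w t m).
have E (f : M -> F) : \sum_m (\sum_t l t * w t m) * f m = \sum_t l t * \sum_m w t m * f m.
  under eq_bigr do rewrite mulr_suml.
  rewrite exchange_big; apply: eq_bigr => t _; rewrite mulr_sumr.
  by apply: eq_bigr => m _; rewrite mulrA.
split=> [m|j jA|]; rewrite ?E //.
  by apply: sumr_ge0 => t _; rewrite mulr_ge0.
have [->|jj0] := eqVneq j j0; first by rewrite big1 // => t _; rewrite wj0 mulr0.
by apply: la; rewrite !inE jj0.
Qed.

(** Farkas multipliers of the demand rows give [y], those of the capacity rows give [l]. The
    multipliers of the rows [x >= 0] are the slack that turns the vanishing of each column into an
    inequality. *)
Lemma packing_dual (R : realType) (I : instance R) (tau : R) :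
    ~ (exists x, @packs R I x tau) ->
  exists (l : {set vertex I} -> R) (y : 'I_(nsess I) -> R),
    [/\ forall e, 0 <= l e, forall i, 0 <= y i,
      forall i T, steiner_tree i T -> y i <= \sum_(e in T.2) l e &
      \sum_(e in edges I) cap e * l e < tau * \sum_i y i * dem i].
Proof.
pose J := ('I_(nsess I) * ({set vertex I} * {set {set vertex I}}))%type.
pose A := [set j : J | steiner_tree j.1 j.2].
pose M := ('I_(nsess I) + ({set vertex I} + J))%type.
pose a (m : M) (j : J) : R := match m with
  | inl i => - (j.1 == i)%:R
  | inr (inl e) => ((e \in edges I) && (e \in j.2.2))%:R
  | inr (inr j') => - (j' == j)%:R end.
pose b (m : M) : R := match m with
  | inl i => - (tau * dem i)
  | inr (inl e) => (e \in edges I)%:R * cap e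
  | inr (inr _) => 0 end.
have sumA (f : J -> R) : \sum_(j in A) f j = \sum_i \sum_(T | steiner_tree i T) f (i, T).
  by rewrite pair_big_dep /=; apply: eq_big => [j|[]] //; rewrite inE.
have [[x xP] []|[u [u0 ua ub]] _] := farkas A a b.
  exists (fun i T => x (i, T)); split=> [i T iT|i|e eE].
  - have := xP (inr (inr (i, T))); rewrite /= (bigD1 (i, T)) ?inE //= eqxx mulN1r.
    rewrite big1 ?addr0 ?oppr_le0 // => j /andP[_].
    by rewrite eq_sym => /negPf->; rewrite oppr0 mul0r.
  - have := xP (inl i); rewrite /= sumA (bigD1 i) //= [X in _ + X]big1 ?addr0; last first.
      by move=> i' /negPf ii; apply: big1 => T _; rewrite ii oppr0 mul0r.
    under eq_bigr do rewrite eqxx mulN1r.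
    by rewrite sumrN lerN2.
  - have := xP (inr (inl e)); rewrite /= sumA eE mul1r; apply: le_trans.
    apply: ler_sum => i _; rewrite big_mkcondr; apply: ler_sum => T _.
    by case: (e \in T.2); rewrite ?mul1r ?mul0r.
exists (fun e => u (inr (inl e))), (fun i => u (inl i)); split=> // [i T iT|].
  have TE : T.2 \subset edges I by case/andP: iT => /and5P[].
  have := ua (i, T); rewrite inE => /(_ iT).
  rewrite !big_sumType /= (bigD1 i) //= eqxx mulrN1 big1 ?addr0; last first.
    by move=> i'; rewrite eq_sym => /negPf->; rewrite oppr0 mulr0.
  have -> : \sum_e u (inr (inl e)) * ((e \in edges I) && (e \in T.2))%:R
      = \sum_(e in T.2) u (inr (inl e)).
    rewrite [RHS]big_mkcond; apply: eq_bigr => e _.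
    case: (boolP (e \in T.2)) => [/(subsetP TE)->|_]; rewrite ?mulr1 //.
    by rewrite andbF mulr0.
  set S := \sum_(j : J) _.
  have S0 : S <= 0 by apply: sumr_le0 => j _; rewrite mulrN oppr_le0 mulr_ge0.
  lra.
move: ub; rewrite !big_sumType /= [X in _ + (_ + X)]big1; last by move=> j _; rewrite mulr0.
rewrite addr0 mulr_sumr.
have -> : \sum_i u (inl i) * - (tau * dem i) = - \sum_i tau * (u (inl i) * dem i).
  by rewrite -sumrN; apply: eq_bigr => i _; rewrite mulrN mulrCA.
rewrite addrC subr_lt0; apply: le_lt_trans.
rewrite big_mkcond; apply: ler_sum => e _.
by case: (e \in edges I); rewrite ?mul1r ?mul0r ?mulr0 // mulrC.
Qed.

(** * Entropy and the cut bound *)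

(** Grouping the outcomes by value turns the sum over the range into an expectation over [W]. *)
Lemma entropyE (R : realType) (W : finType) (P : W -> R) (T : Type) (X : W -> T) :
  entropy P X = - \sum_w P w * ln (mass_fun P X (X w)).
Proof.
rewrite /entropy fsbig_finite; last by apply: finite_image; apply: finite_finset.
congr (- _); rewrite /mass_fun.
under eq_bigr do rewrite mulr_suml.
rewrite (exchange_big_dep xpredT) //=; apply: eq_bigr => w _.
have XwX : (X w : {classic T}) \in fset_set (range (X : W -> {classic T})).
  rewrite in_fset_set; last by apply: finite_image; apply: finite_finset.
  by apply: mem_set; exists w.
rewrite big_mkcond /= (big_fsetD1 _ XwX) /= asboolT // big1_fset ?addr0 // => x.
by rewrite in_fsetD1 => /andP[xX _] _; rewrite asboolF // => e; rewrite e eqxx in xX.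
Qed.

Lemma mass_fun_bounds (R : realType) (W : finType) (P : W -> R) (T : Type) (X : W -> T) w :
  (forall w, 0 <= P w) -> \sum_w P w = 1 -> P w <= mass_fun P X (X w) <= 1.
Proof.
move=> P0 P1; rewrite /mass_fun; apply/andP; split.
  by rewrite (bigD1 w) ?asboolT //= lerDl sumr_ge0.
rewrite -P1 [leRHS](bigID (fun w' => `[< X w' = X w >])) /= lerDl.
by rewrite sumr_ge0.
Qed.

Lemma entropy_ge0 (R : realType) (W : finType) (P : W -> R) (T : Type) (X : W -> T) :
  (forall w, 0 <= P w) -> \sum_w P w = 1 -> 0 <= entropy P X.
Proof.
move=> P0 P1; rewrite entropyE oppr_ge0; apply: sumr_le0 => w _.
by rewrite mulr_ge0_le0 // ln_le0 //; case/andP: (mass_fun_bounds X w P0 P1).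
Qed.

Lemma eq_entropy (R : realType) (W : finType) (P : W -> R) (T S : Type)
    (X : W -> T) (Y : W -> S) :
  (forall w w', X w = X w' <-> Y w = Y w') -> entropy P X = entropy P Y.
Proof.
move=> XY; rewrite !entropyE; congr (- _); apply: eq_bigr => w _; congr (_ * ln _).
by apply: eq_bigl => w'; apply: asbool_equiv_eq.
Qed.

Lemma entropy_cst (R : realType) (W : finType) (P : W -> R) (T : Type) (x : T) :
  \sum_w P w = 1 -> entropy P (fun=> x) = 0.
Proof.
move=> P1; rewrite entropyE big1 ?oppr0 // => w _.
rewrite /mass_fun (eq_bigl xpredT) => [|w']; last by rewrite asboolT.
by rewrite P1 ln1 mulr0.
Qed.

Lemma ln_prod (R : realType) (J : finType) (f : J -> R) :
  (forall j, 0 < f j) -> ln (\prod_j f j) = \sum_j ln (f j).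
Proof.
move=> f0.
suff [] : 0 < \prod_j f j /\ ln (\prod_j f j) = \sum_j ln (f j) by [].
elim/big_ind2: _ => [|x y u v [x0 <-] [u0 <-]|j _] //; first by rewrite ln1.
by rewrite mulr_gt0 // lnM.
Qed.

(** The product of the marginals is a probability law on tuples of values, and distinct outcomes
    give distinct tuples. Level sets [cl j w] stand in for the values, which need not lie in a
    finite type. *)
Lemma sum_prod_mass_le1 (R : realType) (W J : finType) (P : W -> R) (T : J -> Type)
    (Z : forall j, W -> T j) :
    (forall w, 0 <= P w) -> \sum_w P w = 1 ->
    (forall w w', (forall j, Z j w = Z j w') -> w = w') ->
  \sum_w \prod_j mass_fun P (Z j) (Z j w) <= 1.
Proof.
move=> P0 P1 Zinj.
pose cl j w := [set w' | `[< Z j w' = Z j w >]].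
have clP j w w' : (cl j w' == cl j w) = `[< Z j w' = Z j w >].
  apply/eqP/asboolP => [/setP/(_ w')|E]; last by rewrite /cl E.
  by rewrite !inE asboolT // => /esym/asboolP.
pose m j (C : {set W}) := \sum_(w | cl j w == C) P w.
have mE j w : mass_fun P (Z j) (Z j w) = m j (cl j w).
  by apply: eq_bigl => w'; rewrite clP.
have m1 j : \sum_C m j C = 1.
  by rewrite -P1 [RHS](partition_big (cl j) xpredT).
apply: (@le_trans _ _ (\prod_(j : J) \sum_C m j C)); last by rewrite big1.
rewrite bigA_distr_bigA.
pose h w := [ffun j => cl j w].
have hinj : injective h.
  move=> w w' /ffunP hw; apply: Zinj => j.
  by have := hw j; rewrite !ffunE => /eqP; rewrite clP => /asboolP.
have -> : \sum_w \prod_j mass_fun P (Z j) (Z j w) = \sum_w \prod_j m j (h w j).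
  by apply: eq_bigr => w _; apply: eq_bigr => j _; rewrite mE ffunE.
have m0 (f : {ffun J -> {set W}}) : 0 <= \prod_j m j (f j).
  by apply: prodr_ge0 => j _; apply: sumr_ge0.
have -> : \sum_w \prod_j m j (h w j) = \sum_(f in h @: [set: W]) \prod_j m j (f j).
  by rewrite big_imset /=; [apply: eq_bigl => w; rewrite inE|exact: in2W].
by rewrite [leRHS](bigID [in h @: [set: W]]) /= lerDl sumr_ge0.
Qed.

(* Gibbs' inequality against the product of the marginal laws of the [Z j],
   which has total mass at most 1 because the [Z j] separate the outcomes. *)
Lemma entropy_le_sum (R : realType) (W J : finType) (P : W -> R) (T : J -> Type)
    (Z : forall j, W -> T j) :
    (forall w, 0 <= P w) -> \sum_w P w = 1 ->
    (forall w w', (forall j, Z j w = Z j w') -> w = w') ->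
  - \sum_w P w * ln (P w) <= \sum_j entropy P (Z j).
Proof.
move=> P0 P1 Zinj.
pose q w := \prod_j mass_fun P (Z j) (Z j w).
under [leRHS]eq_bigr do rewrite entropyE.
rewrite sumrN exchange_big /= lerN2 -subr_le0 -sumrB.
under eq_bigr do rewrite -mulr_sumr -mulrBr.
apply: (@le_trans _ _ (\sum_w (q w - P w))); last first.
  by rewrite sumrB subr_le0 P1 sum_prod_mass_le1.
apply: ler_sum => w _.
have [Pw|Pw] := eqVneq (P w) 0.
  rewrite Pw mul0r subr0; apply: prodr_ge0 => j _.
  by apply: le_trans (P0 w) _; case/andP: (mass_fun_bounds (Z j) w P0 P1).
have {}Pw : 0 < P w by rewrite lt0r Pw P0.
have mpos j : 0 < mass_fun P (Z j) (Z j w).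
  by apply: lt_le_trans Pw _; case/andP: (mass_fun_bounds (Z j) w P0 P1).
have q0 : 0 < q w by apply: prodr_gt0.
rewrite -ln_prod // -/(q w) -ln_div ?posrE // -ler_pdivlMl //.
rewrite -[q w / P w](subrK 1) addrC.
apply: le_trans (le_ln1Dx _) _; first by rewrite ltrBrDl subrr divr_gt0.
by rewrite mulrBr mulVf ?gt_eqF // mulrC.
Qed.

(** Distributivity for dependent functions, by transport to [fprod]; it yields the total mass and
    the marginals of the product law. *)
Lemma sum_dffun_prod (R : realType) (I : finType) (M : I -> finType) (f : forall i, M i -> R) :
  \sum_(w : {dffun forall i, M i}) \prod_i f i (w i) = \prod_i \sum_(m : M i) f i m.
Proof.
pose P i := [ffun m => f i m].
have bij : {on xpredT, bijective (@fprod_of_dffun I M)} by exact/onW_bij/fprod_of_dffun_bij.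
transitivity (\sum_(t : fprod M) \prod_(i in I) P i (t i)).
  rewrite (reindex _ bij); apply: eq_bigr => w _; apply: eq_bigr => i _.
  by rewrite ffunE fprodE.
rewrite big_fprod -(bigA_distr_big_dep (tagged_with M) (fun i => untag 0 (P i))).
apply: eq_bigr => i _.
rewrite -(big_tag (fun i m => P i m)).
by apply: eq_bigr => m _; rewrite ffunE.
Qed.

Lemma joint_law_ge0 (R : realType) (I : instance R) (N : solution I) w :
  0 <= @joint_law R I N w.
Proof. by apply: prodr_ge0 => i _; apply: law_ge0. Qed.

Lemma joint_law_sum1 (R : realType) (I : instance R) (N : solution I) :
  \sum_w @joint_law R I N w = 1.
Proof. by rewrite /joint_law sum_dffun_prod big1 // => i _; apply: law_sum1. Qed.

Lemma mass_fun_message (R : realType) (I : instance R) (N : solution I) i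
    (m : msg N i) :
  mass_fun (@joint_law R I N) (fun w => w i) m = law m.
Proof.
(* The indicator of [w i = m] as a product over coordinates; [Tagged] compares elements whose types
   are identified only when [j = i]. *)
pose f j (x : msg N j) := law x * ((j != i) || (Tagged (msg N) x == Tagged (msg N) m))%:R.
transitivity (\sum_(w : messages (msg N)) \prod_j f j (w j)).
  rewrite /mass_fun big_mkcond; apply: eq_bigr => w _.
  rewrite /f big_split /= -/(joint_law w).
  case: asboolP => [wi|/eqP wi].
    rewrite big1 ?mulr1 // => j _; have [->|//] := eqVneq j i.
    by rewrite wi eqxx.
  rewrite [X in _ * X](bigD1 i) //= eqxx /= -tag_eqE /tag_eq eqxx /= tagged_asE.
  by rewrite (negPf wi) mul0r mulr0.
rewrite sum_dffun_prod (bigD1 i) //= [X in _ * X]big1 ?mulr1 => [|j ji]; last first.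
  by rewrite /f; under eq_bigr do rewrite ji /= mulr1; exact: law_sum1.
rewrite (bigD1 m) //= /f !eqxx /= mulr1 big1 ?addr0 // => x xm.
by rewrite -tag_eqE /tag_eq eqxx /= tagged_asE (negPf xm) mulr0.
Qed.

(** By independence [ln] of the joint law splits over the sessions; outcomes of probability zero,
    where it may not split, contribute nothing. *)
Lemma sum_message_entropy (R : realType) (I : instance R) (N : solution I) :
  \sum_i message_entropy N i = - \sum_w joint_law w * ln (@joint_law R I N w).
Proof.
under eq_bigr do rewrite /message_entropy entropyE.
rewrite sumrN exchange_big /=; congr (- _); apply: eq_bigr => w _.
rewrite -mulr_sumr; have [->|wn0] := eqVneq (joint_law w) 0; first by rewrite !mul0r.
congr (_ * _); rewrite -ln_prod => [|i].
  by congr ln; apply: eq_bigr => i _; rewrite mass_fun_message.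
rewrite mass_fun_message lt0r law_ge0 andbT.
by move: wn0; rewrite /joint_law => /prodf_neq0; apply.
Qed.

(** Induction on time from the start given by [startP]: a symbol leaving a vertex of [U] is encoded
    from the symbols that arrived there one step earlier and the messages held there. *)
Lemma symbol_determined (R : realType) (I : instance R) (N : solution I)
    (U : {set vertex I}) (w w' : messages (msg N)) :
    (forall i, src i \in U -> w i = w' i) ->
    (forall u v, u \notin U -> v \in U -> time_arc u v ->
      forall t, symbol u v t w = symbol u v t w') ->
  forall u v t, v \in U -> time_arc u v -> symbol u v t w = symbol u v t w'.
Proof.
move=> Hm Hin u v t vU uv.
have [t0 st] := startP N.
have [tt0|/ltW t0t] := leP t t0; first exact: st.
have -> : t = t0 + `|t - t0|%N%:Z by rewrite gez0_abs ?subr_ge0 //; lia.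
elim: `|t - t0|%N u v vU uv => {t t0t} [|n IHn] u v vU uv; first by apply: st; rewrite ?addr0.
have [uU|uU] := boolP (u \in U); last exact: Hin.
rewrite !encodeP //; congr (encode _ _ _ _ _).
  apply/funext => x; rewrite /arriving; case: ifP => // xu; congr Some.
  by rewrite (_ : _ - 1 = t0 + n%:Z) ?IHn //; lia.
apply: functional_extensionality_dep => i; rewrite /own_messages.
by case: eqP => // iu; rewrite Hm // iu.
Qed.

(** [entropy_le_sum] is applied to the messages that do not cross into [U] and the symbols on the
    arcs into [U]. Its left side is the sum of all message entropies, from which the non-crossing
    ones cancel. *)
Lemma cut_bound (R : realType) (I : instance R) (N : solution I) (U : {set vertex I}) :
  \sum_(i | (src i \notin U) && [exists r in sinks i, r \in U]) message_entropy N i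
  <= \sum_u \sum_v
    ((u \notin U) && (v \in U) && ([set u; v] \in edges I))%:R * arc_entropy N u v.
Proof.
pose P := @joint_law R I N.
have P0 := @joint_law_ge0 R I N; have P1 := @joint_law_sum1 R I N.
pose crossing i := (src i \notin U) && [exists r in sinks i, r \in U].
pose arc_in (u v : vertex I) := (u \notin U) && (v \in U) && ([set u; v] \in edges I).
pose J := ('I_(nsess I) + vertex I * vertex I)%type.
pose T (j : J) : Type := match j with
  | inl i => option (msg N i) | inr _ => option (int -> alphabet N) end.
(* Crossing messages and arcs not entering [U] are replaced by the constant [None], of entropy
   zero. *)
pose Z (j : J) : messages (msg N) -> T j := match j with
  | inl i => fun w => if crossing i then None else Some (w i)
  | inr (u, v) => fun w => if arc_in u v then Some (fun t => symbol u v t w) else None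
  end.
have Zinj w w' : (forall j, Z j w = Z j w') -> w = w'.
  move=> ZE; have own i : ~~ crossing i -> w i = w' i.
    by move=> /negPf ci; have := ZE (inl i); rewrite /= ci => -[].
  have inU u v : u \notin U -> v \in U -> time_arc u v ->
      forall t, symbol u v t w = symbol u v t w'.
    move=> uU vU /orP[/eqP uv|uv] t; first by rewrite uv vU in uU.
    have := ZE (inr (u, v)); rewrite /= /arc_in uU vU uv /= => -[].
    by move/(congr1 (fun f => f t)).
  (* A crossing message is decoded at a sink inside [U], where every arriving symbol is already
     determined. *)
  apply/ffunP => i; have [|/own //] := boolP (crossing i).
  case/andP => iU /exists_inP[r ri rU].
  rewrite -(@decodeP R I N i r w ri) -(@decodeP R I N i r w' ri).
  congr (@Defs.decode _ _ _ _ _ _).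
  apply/funext => t; apply/funext => x; rewrite /arriving; case: ifP => // xr; congr Some.
  apply: (@symbol_determined R I N U) => // j jU; apply: own.
  by rewrite /crossing jU.
have := @entropy_le_sum R _ J P T Z P0 P1 Zinj.
rewrite -sum_message_entropy big_sumType /= [leLHS](bigID crossing) /=.
have -> : \sum_i entropy P (Z (inl i)) = \sum_(i | ~~ crossing i) message_entropy N i.
  rewrite [RHS]big_mkcond; apply: eq_bigr => i _ /=.
  case: (crossing i); first exact: entropy_cst.
  by apply: eq_entropy => w w'; split=> [[]|->].
rewrite addrC lerD2l => /le_trans; apply.
rewrite pair_bigA /=; apply: ler_sum => -[u v] _ /=.
rewrite -/(arc_in u v); case: (arc_in u v); last by rewrite mul0r entropy_cst.
rewrite mul1r /arc_entropy le_eqVlt; apply/orP; left; apply/eqP.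
by apply: eq_entropy => w w'; split=> [[]|->].
Qed.

(** * The gap *)

(** Scaling the dual solution by a large integer makes room for rounding the lengths to integers
    above [2] while the strict gap survives. *)
Lemma integral_packing_dual (R : realType) (I : instance R) (tau : R) :
    ~ (exists x, @packs R I x tau) ->
  exists (l : {set vertex I} -> nat) (y : 'I_(nsess I) -> R),
    [/\ forall e, (2 < l e)%N, forall i, 0 <= y i,
      forall i F, (forall r, r \in sinks i -> connect (edge_rel F) (src i) r) ->
        y i <= (cost l F)%:R &
      \sum_(e in edges I) cap e * (l e)%:R < tau * \sum_i y i * dem i].
Proof.
move=> /packing_dual[l [y [l0 y0 yl gap]]].
pose E := edges I; pose c := \sum_(e in E) cap e.
pose g := tau * (\sum_i y i * dem i) - \sum_(e in E) cap e * l e.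
have g0 : 0 < g by rewrite subr_gt0.
have c0 : 0 <= c by apply: sumr_ge0 => e; apply: cap_ge0.
(* Rounding adds at most [4 * c] in total, which the scaled gap [n * g] must exceed. *)
pose n := (Num.truncn (4 * c / g)).+1.
have ng : 4 * c < n%:R * g by rewrite -ltr_pdivrMr // truncnS_gt.
pose Y i := n%:R * y i.
have Y0 i : 0 <= Y i by rewrite mulr_ge0.
pose big := Num.truncn (\sum_i Y i).
(* The [4] covers the truncation and keeps the lengths above [2]. Outside the graph a length is at
   least every [Y i], so an edge set that leaves the graph meets the bound at once. *)
pose l' e := if e \in E then (Num.truncn (n%:R * l e) + 4)%N else (big + 4)%N.
have Ybig i : Y i <= (big + 4)%:R.
  apply: (@le_trans _ _ (\sum_i Y i)).
    by rewrite (bigD1 i) //= lerDl sumr_ge0.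
  apply: ltW; apply: lt_le_trans (truncnS_gt _) _.
  by rewrite ler_nat -addn1 leq_add2l.
exists l', Y; split=> [e|//|i F Fc|].
- by rewrite /l'; case: ifP => _; rewrite addn4.
- have [FE|/subsetPn[e eF eE]] := boolP (F \subset E); last first.
    apply: le_trans (Ybig i) _; rewrite ler_nat /cost (bigD1 e) //=.
    by rewrite {1}/l' (negPf eE) leq_addr.
  have [T iT TF] := steiner_tree_in FE Fc.
  have TE := subset_trans TF FE.
  apply: (@le_trans _ _ (n%:R * \sum_(e in T.2) l e)).
    by rewrite ler_wpM2l // yl.
  rewrite mulr_sumr; apply: (@le_trans _ _ (cost l' T.2)%:R).
    rewrite /cost natr_sum; apply: ler_sum => e eT.
    rewrite /l' (subsetP TE) //; apply: ltW; apply: lt_le_trans (truncnS_gt _) _.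
    by rewrite ler_nat -addn1 leq_add2l.
  rewrite ler_nat /cost [leqRHS](big_setID T.2) /=.
  by rewrite (setIidPr TF) leq_addr.
have -> : \sum_i Y i * dem i = n%:R * \sum_i y i * dem i.
  by rewrite mulr_sumr; apply: eq_bigr => i _; rewrite mulrA.
apply: (@le_lt_trans _ _ (n%:R * (\sum_(e in E) cap e * l e) + 4 * c)).
  rewrite !mulr_sumr -big_split; apply: ler_sum => e eE /=.
  rewrite /l' -/E eE natrD mulrDr [4 * _]mulrC [n%:R * (_ * _)]mulrCA.
  rewrite lerD2r ler_wpM2l ?cap_ge0 // truncn_le mulr_ge0 //.
by move: ng; rewrite /g mulrBr mulrCA; lra.
Qed.

(** A separation at level [k] of the refinement is charged to some [j >= k] with [P j u != P j v];
    such a [j] is charged at most the sum of [2 ^ k] over [k <= j], which is below [2 ^ j.+1]. *)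
Lemma sum_block_separation (V : finType) (P : nat -> V -> V) (K : nat) (u v : V) :
  (\sum_(0 <= k < K) 2 ^ k * (v \notin block P K k u)
    <= \sum_(0 <= j < K) 2 ^ j.+1 * (P j u != P j v))%N.
Proof.
apply: (@leq_trans (\sum_(0 <= k < K) \sum_(0 <= j < K)
    2 ^ k * ((k <= j) && (P j u != P j v)))%N).
  apply: leq_sum => k _; rewrite -big_distrr leq_mul2l; apply/orP; right => /=.
  case: (boolP (v \in _)) => //; rewrite inE => /forallPn[j].
  rewrite negb_imply => kj; rewrite big_mkord (bigD1 j) //= kj.
  exact: leq_addr.
rewrite exchange_big /= big_nat [leqRHS]big_nat; apply: leq_sum => j /andP[_ jK].
case: (P j u != P j v); last by rewrite big1 // => k _; rewrite andbF muln0.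
rewrite muln1 -sum_pow2; apply: leq_trans (leqnSn _).
rewrite [leqRHS](big_nat_widen _ _ _ _ _ jK) [leqRHS]big_mkcond.
apply: leq_sum => k _; rewrite andbT ltnS.
by case: (k <= j)%N; rewrite ?muln1 ?muln0.
Qed.

(** [cut_bound] is summed over the blocks of level [k]. These are disjoint, so an arc can only enter
    the block of its head, and does so when its tail lies outside. *)
Lemma level_bound (R : realType) (I : instance R) (N : solution I)
    (P : nat -> vertex I -> vertex I) K k :
  \sum_i message_entropy N i *
    #|[set block P K k r | r in sinks i] :\ block P K k (src i)|%:R
  <= \sum_u \sum_v ([set u; v] \in edges I)%:R * arc_entropy N u v
       * (v \notin block P K k u)%:R.
Proof.
pose cl := [set block P K k u | u in [set: vertex I]].
pose crossing i (C : {set vertex I}) := (src i \notin C) && [exists r in sinks i, r \in C].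
have H0 i : 0 <= message_entropy N i.
  by apply: entropy_ge0; [exact: joint_law_ge0 | exact: joint_law_sum1].
have A0 u v : 0 <= arc_entropy N u v.
  by apply: entropy_ge0; [exact: joint_law_ge0 | exact: joint_law_sum1].
apply: (@le_trans _ _ (\sum_(C in cl) \sum_(i | crossing i C) message_entropy N i)).
  under [leRHS]eq_bigr do rewrite big_mkcond.
  rewrite exchange_big; apply: ler_sum => i _ /=.
  rewrite -big_mkcondr /= sumr_const -[leRHS]mulr_natr ler_wpM2l // ler_nat.
  apply/subset_leq_card/subsetP => C; rewrite !inE => /andP[Cs /imsetP[r ri Cr]].
  apply/and3P; split; first by apply/imsetP; exists r; rewrite ?inE.
    by rewrite Cr -eq_block -Cr.
  by apply/exists_inP; exists r; rewrite // Cr block_self.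
apply: (@le_trans _ _ (\sum_(C in cl) \sum_u \sum_v
    ((u \notin C) && (v \in C) && ([set u; v] \in edges I))%:R * arc_entropy N u v)).
  by apply: ler_sum => C _; apply: cut_bound.
rewrite exchange_big; apply: ler_sum => u _ /=.
rewrite exchange_big; apply: ler_sum => v _ /=.
rewrite -mulr_suml [leRHS]mulrAC ler_wpM2r // -natrM -natr_sum ler_nat.
rewrite (bigD1 (block P K k v)) /=; last by apply/imsetP; exists v; rewrite ?inE.
rewrite big1 ?addn0 => [|C /andP[/imsetP[x _ ->] xv]].
  rewrite block_self blockC andbT.
  by case: (v \in _); case: (_ \in edges I).
by rewrite eq_block in xv; rewrite (negPf xv) andbF.
Qed.

(** Ordered pairs are grouped by edge; each edge arises from exactly its two orientations, which
    share its capacity. *)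
Lemma sum_arcs_le (R : realType) (I : instance R) (h : vertex I -> vertex I -> R)
    (l : {set vertex I} -> nat) (s : R) :
    (forall u v, [set u; v] \in edges I -> h u v + h v u <= cap [set u; v] * s) ->
  \sum_u \sum_v ([set u; v] \in edges I)%:R * h u v * (l [set u; v])%:R
    <= s * \sum_(e in edges I) cap e * (l e)%:R.
Proof.
move=> hc; rewrite pair_bigA /=.
under eq_bigr do rewrite -mulrA.
rewrite (eq_bigr (fun p => if [set p.1; p.2] \in edges I
    then h p.1 p.2 * (l [set p.1; p.2])%:R else 0)); last first.
  by move=> p _; case: ifP; rewrite ?mul1r ?mul0r.
rewrite -big_mkcond (partition_big (fun p => [set p.1; p.2]) (fun e => e \in edges I)) //=.
rewrite mulr_sumr; apply: ler_sum => e eE.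
have /eqP/cards2P[x [y [xy exy]]] := edges_card eE.
have pxy (p : vertex I * vertex I) : [set p.1; p.2] = e -> p = (x, y) \/ p = (y, x).
  case: p => u v /= E; have := edges_card eE; rewrite -E cards2.
  have := set21 u v; have := set22 u v; rewrite E exy !inE.
  by case/orP=> /eqP-> /orP[]/eqP->; rewrite ?eqxx // => _; [right|left].
rewrite (bigD1 (x, y)) /=; last by rewrite -exy eE eqxx.
rewrite (bigD1 (y, x)) /=; last by rewrite setUC -exy eE eqxx /= xpair_eqE negb_and eq_sym xy.
rewrite big1 ?addr0 => [|p]; last first.
  by case/andP => /andP[/andP[_ /eqP/pxy[]->]]; rewrite eqxx.
rewrite [[set y; x]]setUC -exy -mulrDl mulrA ler_wpM2r // mulrC exy.
by rewrite hc // -exy.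
Qed.

Lemma harmonic_sum_le_ln (R : realType) n : harmonic_sum R n.+1 <= 1 + ln n.+1%:R.
Proof.
elim: n => [|n IHn]; rewrite /harmonic_sum big_nat_recr //=.
  by rewrite big_geq // add0r invr1 ln1 addr0.
apply: le_trans (lerD IHn (lexx _)) _; rewrite -addrA lerD2l -lerBrDl.
have p : (0 : R) < n.+1%:R / n.+2%:R by rewrite divr_gt0 ?ltr0n.
have -> : ln n.+2%:R - ln n.+1%:R = - ln (n.+1%:R / n.+2%:R) :> R.
  by rewrite ln_div ?posrE ?ltr0n // opprB.
(* The increment is bounded by [ln (1 - x) <= - x] at [x = 1 / (n + 2)]. *)
have /le_ln1Dx : -1 < - (n.+2%:R : R)^-1.
  by rewrite ltrN2 invf_lt1 ?ltr0n // ltr1n.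
rewrite lerNr (_ : 1 - _ = n.+1%:R / n.+2%:R) //.
by rewrite -[X in X - _](@mulfV _ n.+2%:R) ?pnatr_eq0 //
  -[X in _ - X]mul1r -mulrBl -natr1 addrK.
Qed.

(** The arc entropies of the coding solution are the weights for which the partitions are chosen;
    the resulting bound on [s * rho * \sum_i y i * dem i] contradicts the strict gap of the dual
    solution. *)
Lemma achieves_packs (R : realType) (I : instance R) (N : solution I) (rho tau : R) :
    (0 < #|vertex I|)%N -> achieves N rho -> 0 < rho ->
    16 * harmonic_sum R #|vertex I| * tau <= rho ->
  exists x, @packs R I x tau.
Proof.
move=> V0 [s s0 [Hm Ha]] rho0 rhotau; apply: contrapT.
move=> /integral_packing_dual[l [y [l3 y0 yF gap]]].
set n := #|vertex I| in V0 rhotau; set H := harmonic_sum R n in rhotau.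
have Hpos : 0 < H.
  rewrite /H /harmonic_sum -(prednK V0) big_nat_recl //= invr1 ltr_wpDr //.
  exact: sumr_ge0.
pose d := dist l.
have d3 u v : u != v -> (2 < d u v)%N by apply: dist_lower_bound.
pose K := (\max_u \max_v d u v)%N.
have dK u v : (d u v < 2 ^ K)%N.
  apply: leq_ltn_trans (ltn_expl K (ltnSn 1)).
  by rewrite /K (leq_trans _ (leq_bigmax u)) // (leq_bigmax (F := d u) v).
pose a u v := ([set u; v] \in edges I)%:R * arc_entropy N u v.
have a0 u v : 0 <= a u v.
  by rewrite mulr_ge0 // entropy_ge0 //; [exact: joint_law_ge0 | exact: joint_law_sum1].
have [P [Pd Pa]] := @low_diameter_partitions R _ d a K (distxx l) (distC l) (dist_triangle l) a0.
pose q k i := #|[set block P K k r | r in sinks i] :\ block P K k (src i)|.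
have yq i : y i <= 8 * \sum_(0 <= k < K) 2 ^+ k * (q k i)%:R.
  have [F Fc Fcost] := @spanning_cost _ l P K (src i) (enum (sinks i)) Pd dK d3.
  have : y i <= (cost l F)%:R by apply: yF => r ri; apply: Fc; rewrite mem_enum.
  move=> /le_trans; apply.
  rewrite -(ler_nat R) natrM natr_sum in Fcost; apply: le_trans Fcost _.
  rewrite ler_wpM2l //; apply: ler_sum => k _; rewrite natrM natrX ler_wpM2l //.
  rewrite ler_nat /q; apply/eq_leq/eq_card => C; rewrite !inE; congr (_ && _).
  by apply/imsetP/imsetP => -[r rs ->]; exists r; rewrite ?mem_enum // in rs *.
have key : s * rho * \sum_i y i * dem i <= 16 * H * \sum_u \sum_v a u v * (d u v)%:R.
  apply: (@le_trans _ _ (8 * \sum_(0 <= k < K)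
      2 ^+ k * \sum_i message_entropy N i * (q k i)%:R)).
    apply: (@le_trans _ _ (\sum_i
      message_entropy N i * (8 * \sum_(0 <= k < K) 2 ^+ k * (q k i)%:R))).
      rewrite mulr_sumr; apply: ler_sum => i _.
      have dem0 := dem_gt0 i.
      have -> : s * rho * (y i * dem i) = rho * dem i * s * y i by ring.
      by apply: ler_pM => //; rewrite !mulr_ge0 // ltW.
    rewrite le_eqVlt; apply/orP; left; apply/eqP.
    under eq_bigr do rewrite mulrCA mulr_sumr.
    rewrite -mulr_sumr exchange_big; congr (_ * _); apply: eq_bigr => k _.
    by rewrite mulr_sumr; apply: eq_bigr => i _; rewrite mulrCA.
  (* The [8] comes from [spanning_cost], the [2] from [sum_block_separation]. *)
  rewrite -[16 * H * _]mulrA (_ : 16 = 8 * 2 :> R); last by rewrite -natrM.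
  rewrite -mulrA ler_wpM2l //.
  apply: le_trans (ler_wpM2l _ Pa) => //.
  apply: (@le_trans _ _ (\sum_(0 <= k < K) 2 ^+ k *
      \sum_u \sum_v a u v * (v \notin block P K k u)%:R)).
    by apply: ler_sum => k _; rewrite ler_wpM2l // level_bound.
  rewrite mulr_sumr.
  under eq_bigr do rewrite mulr_sumr.
  under [leRHS]eq_bigr do rewrite mulrA -exprS mulr_sumr.
  rewrite exchange_big [leRHS]exchange_big; apply: ler_sum => u _ /=.
  under eq_bigr do rewrite mulr_sumr.
  under [leRHS]eq_bigr do rewrite mulr_sumr.
  rewrite exchange_big [leRHS]exchange_big; apply: ler_sum => v _ /=.
  under eq_bigr do rewrite mulrCA -natrX -natrM.
  under [leRHS]eq_bigr do rewrite mulrCA -natrX -natrM.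
  by rewrite -!mulr_sumr ler_wpM2l // -!natr_sum ler_nat sum_block_separation.
have ad : \sum_u \sum_v a u v * (d u v)%:R <= s * \sum_(e in edges I) cap e * (l e)%:R.
  apply: le_trans (sum_arcs_le (h := arc_entropy N) l Ha).
  apply: ler_sum => u _; apply: ler_sum => v _.
  by rewrite ler_wpM2l ?a0 // ler_nat dist_edge.
have yd0 : 0 <= \sum_i y i * dem i.
  by apply: sumr_ge0 => i _; rewrite mulr_ge0 // ltW // dem_gt0.
suff : s * rho * (\sum_i y i * dem i) < s * rho * (\sum_i y i * dem i) by rewrite ltxx.
apply: le_lt_trans key _.
apply: (@le_lt_trans _ _ (16 * H * (s * \sum_(e in edges I) cap e * (l e)%:R))).
  by rewrite ler_wpM2l // mulr_ge0 // ltW.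
apply: (@lt_le_trans _ _ (16 * H * (s * (tau * \sum_i y i * dem i)))).
  by rewrite ltr_pM2l ?mulr_gt0 // ltr_pM2l.
set Y := \sum_i _ in yd0 *.
have -> : 16 * H * (s * (tau * Y)) = s * (16 * H * tau) * Y by ring.
by rewrite ler_wpM2r // ler_wpM2l // ltW.
Qed.

Theorem theorem1p2 (R : realType) :
  exists C : R, forall I : instance R, (1 < #|vertex I|)%N ->
    (coding_gap I <= (C * ln (#|vertex I|%:R))%:E)%E.
Proof.
have ln2 : 0 < ln 2 :> R by rewrite ln_gt0 // ltr1n.
(* The harmonic sum is at most [1 + ln n], and [1 <= ln n / ln 2] because [n >= 2]. *)
exists (16 * (1 + (ln 2)^-1)) => I n1.
set n := #|vertex I| in n1 *; set c := _ * ln n%:R.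
have ln_n : ln 2 <= ln n%:R :> R by rewrite ler_ln ?posrE ?ltr0n ?ler_nat // ltnW.
have Hn : 16 * harmonic_sum R n <= c.
  rewrite /c -mulrA ler_wpM2l // mulrDl mul1r addrC.
  have := harmonic_sum_le_ln R n.-1; rewrite prednK ?(ltnW n1) // => /le_trans; apply.
  by rewrite lerD2r ler_pdivlMl // mulr1.
have c0 : 0 < c.
  by rewrite !mulr_gt0 ?addr_gt0 ?invr_gt0 // (lt_le_trans ln2).
have bound rho p : (exists N, @achieves R I N rho) -> 0 <= p ->
    (packing_number I <= p%:E)%E -> rho <= c * p.
  move=> [N Nrho] p0 packp; rewrite leNgt; apply/negP => lt_rho.
  have rho0 : 0 < rho by apply: le_lt_trans lt_rho; rewrite mulr_ge0 // ltW.
  (* A packing of value [rho / c] exists, since [c] is at least [16] times the harmonic sum; hence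
     [rho / c <= p]. *)
  have [|x xP] := @achieves_packs R I N rho (rho / c) (ltnW n1) Nrho rho0.
    by rewrite mulrCA; apply: ler_piMr; rewrite ?ler_pdivrMr ?mul1r // ltW.
  have : ((rho / c)%:E <= p%:E)%E.
    by apply: le_trans packp; apply: ereal_sup_ubound; exists (rho / c) => //; exists x.
  by rewrite lee_fin ler_pdivrMr // mulrC leNgt lt_rho.
have pack0 : (0 <= packing_number I)%E.
  apply: ereal_sup_ubound; exists 0 => //; exists (fun _ _ => 0); split=> //.
    by move=> i; rewrite mul0r sumr_ge0.
  by move=> e eE; rewrite big1 ?cap_ge0 // => i _; rewrite big1.
have thr p : 0 <= p -> (packing_number I <= p%:E)%E -> (throughput I <= (c * p)%:E)%E.
  move=> p0 packp; apply: ge_ereal_sup => _ [rho [N Nrho] <-].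
  by rewrite lee_fin bound //; exists N.
(* If the packing number is [+oo], its inverse is [0] and so is the gap. *)
rewrite /coding_gap; case: (packing_number I) pack0 thr => [p||] //= p0 thr; last first.
  by rewrite invey mule0 lee_fin ltW.
rewrite lee_fin in p0; have {}thr := thr p p0 (lexx _); rewrite inver.
(* For [p = 0] the inverse is [+oo], but the throughput is at most [c * 0 = 0], so the product is at
   most [0]. *)
have [pE|pn0] := eqVneq p 0.
  apply: (@le_trans _ _ 0%E); last by rewrite lee_fin ltW.
  by rewrite mule_le0_ge0 ?leey //; rewrite pE mulr0 in thr.
have {pn0}p0 : 0 < p by rewrite lt0r pn0.
rewrite -[c in leRHS](mulfK (lt0r_neq0 p0)) EFinM lee_wpmul2r //.
by rewrite lee_fin invr_ge0 ltW.
Qed.
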